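(* Let $\alpha\in(0,1/2)\cup(1/2,1)$ and set $$C_0=\frac{400}{3}\left(\frac{\Gamma(1-2\alpha)}{\Gamma(1-\alpha)}\right)^2,\qquad C_1=20\,\frac{\Gamma(1-2\alpha)}{\Gamma(1-\alpha)},\qquad C_2=1,\qquad C_3=\frac{\Gamma(1-\alpha)}{60\,\Gamma(1-2\alpha)}.$$ Then the function $$u(x,t)=\frac{C_0}{t^{\alpha}}+C_1\frac{x}{t^{\alpha}}+\frac{x^2}{t^{\alpha}}+C_3\frac{x^3}{t^{\alpha}}$$ satisfies, for all $x\in\mathbb{R}$ and $t>0$, the third order nonlinear time-fractional dispersive equation $$\frac{\partial^\alpha u}{\partial t^\alpha}=\frac{\partial^3}{\partial x^3}\left(\frac{u^2}{2}\right).$$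
   Context: $\Gamma$ is the Euler Gamma function (extended meromorphically to negative non-integer arguments). The symbol $\partial^\alpha/\partial t^\alpha$ denotes the fractional derivative of order $\alpha$ with respect to $t$ (base point $0$) with $x$ fixed. It is a linear operator, and on power functions it acts by the rule $$\frac{d^{\gamma}}{dt^{\gamma}}\,t^{\delta}=\frac{\Gamma(\delta+1)}{\Gamma(\delta-\gamma+1)}\,t^{\delta-\gamma},\qquad \gamma>0,\ \delta\in(-1,0)\cup(0,+\infty),\ t>0.$$ This rule is the convention that defines the fractional derivative of the singular power $t^{-\alpha}$, for which the Caputo integral $\frac{1}{\Gamma(1-\alpha)}\int_0^t (t-\tau)^{-\alpha} f'(\tau)\,d\tau$ does not converge; on these powers with $\delta\in(-1,0)$ it agrees with the Riemann-Liouville derivative $\frac{d}{dt}\frac{1}{\Gamma(1-\alpha)}\int_0^t (t-\tau)^{-\alpha} f(\tau)\,d\tau$ for $0<\gamma=\alpha<1$. *)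

(* Defs.v *)
From Stdlib Require Import Reals Lra List ClassicalEpsilon.
From Coquelicot Require Import Coquelicot.
Open Scope R_scope.

(* Euler's integral, meaningful for 0 < x. *)
Definition Gamma_integral (x : R) : R :=
  RInt_gen (fun t => Rpower t (x - 1) * exp (- t))
    (at_right 0) (Rbar_locally p_infty).

(* x (x + 1) ... (x + n - 1) *)
Fixpoint rising_factorial (x : R) (n : nat) : R :=
  match n with
  | O => 1
  | S k => rising_factorial x k * (x + INR k)
  end.

(* The least n with 0 < x + n; it is 0 when 0 < x. *)
Definition Gamma_shift (x : R) : nat := Z.to_nat (up (- x)).

(* Extension of Euler's integral to negative non-integers by the functional
   equation Gamma (x + n) = x (x + 1) ... (x + n - 1) Gamma x.
   At the poles 0, -1, -2, ... the denominator vanishes, so Gamma x = 0 and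
   c / Gamma x = 0, in agreement with the convention 1 / Gamma = 0 there. *)
Definition Gamma (x : R) : R :=
  Gamma_integral (x + INR (Gamma_shift x))
  / rising_factorial x (Gamma_shift x).

(* Only the values at t > 0 of the functions below are relevant: Rpower t d is
   the real power t^d for t > 0 only. *)

Definition power_exponent (delta : R) : Prop :=
  -1 < delta < 0 \/ 0 < delta.

(* [is_frac_deriv gamma f g]: g is the derivative of order gamma of f, with
   base point 0.  It is the linear operator given by the power rule: the
   smallest linear relation between functions on (0, +oo) containing the
   rule for each admissible exponent. *)
Inductive is_frac_deriv (gamma : R) : (R -> R) -> (R -> R) -> Prop :=
| is_frac_deriv_power (delta : R) :
    power_exponent delta ->
    is_frac_deriv gamma
      (fun t => Rpower t delta)
      (fun t => Gamma (delta + 1) / Gamma (delta - gamma + 1)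
                * Rpower t (delta - gamma))
| is_frac_deriv_linear (a b : R) (f1 f2 g1 g2 : R -> R) :
    is_frac_deriv gamma f1 g1 ->
    is_frac_deriv gamma f2 g2 ->
    is_frac_deriv gamma
      (fun t => a * f1 t + b * f2 t) (fun t => a * g1 t + b * g2 t)
| is_frac_deriv_ext (f1 f2 g1 g2 : R -> R) :
    (forall t, 0 < t -> f1 t = f2 t) ->
    (forall t, 0 < t -> g1 t = g2 t) ->
    is_frac_deriv gamma f1 g1 ->
    is_frac_deriv gamma f2 g2.

(* The value at t of the derivative of order gamma of f.  It is arbitrary when
   f has no such derivative; [frac_deriv_unique] shows that it is
   well defined otherwise. *)
Definition frac_deriv (gamma : R) (f : R -> R) (t : R) : R :=
  epsilon (inhabits 0) (fun l => exists g, is_frac_deriv gamma f g /\ g t = l).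

(* A list of pairs (c, d) stands for the sum of the c t^d; the coefficients
   are multiplied by r d. *)
Fixpoint power_sum (r : R -> R) (L : list (R * R)) (t : R) : R :=
  match L with
  | nil => 0
  | (c, d) :: L' => c * r d * Rpower t d + power_sum r L' t
  end.

Lemma power_sum_ext (r s : R -> R) (L : list (R * R)) (t : R) :
  (forall d, r d = s d) -> power_sum r L t = power_sum s L t.
Proof.
  intros E; induction L as [|[c d] L IH]; simpl; [easy|].
  now rewrite E, IH.
Qed.

Lemma power_sum_linear (a b : R) (r s : R -> R) (L : list (R * R)) (t : R) :
  power_sum (fun d => a * r d + b * s d) L t
  = a * power_sum r L t + b * power_sum s L t.
Proof.
  induction L as [|[c d] L IH]; simpl; [ring|]. rewrite IH; ring.
Qed.

Lemma power_sum_cat (r : R -> R) (L M : list (R * R)) (t : R) :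
  power_sum r (L ++ M) t = power_sum r L t + power_sum r M t.
Proof.
  induction L as [|[c d] L IH]; simpl; [ring|]. rewrite IH; ring.
Qed.

Lemma power_sum_scale (a : R) (r : R -> R) (L : list (R * R)) (t : R) :
  power_sum r (map (fun p => (a * fst p, snd p)) L) t = a * power_sum r L t.
Proof.
  induction L as [|[c d] L IH]; simpl; [ring|]. rewrite IH; ring.
Qed.

Lemma is_derive_power_sum (r : R -> R) (L : list (R * R)) (t : R) :
  0 < t ->
  is_derive (power_sum r L) t (power_sum (fun d => r d * d) L t / t).
Proof.
  intros Ht; induction L as [|[c d] L IH]; simpl.
  - replace (0 / t) with 0 by (field; lra). apply is_derive_Reals.
    apply derivable_pt_lim_const.
  - replace ((c * (r d * d) * Rpower t d
              + power_sum (fun d => r d * d) L t) / t)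
      with (c * r d * (d * Rpower t (d - 1))
            + power_sum (fun d => r d * d) L t / t).
    + apply (is_derive_plus (fun t => c * r d * Rpower t d)); [|exact IH].
      apply is_derive_scal, is_derive_Reals.
      now apply derivable_pt_lim_power.
    + unfold Rminus; rewrite Rpower_plus, Rpower_Ropp, Rpower_1 by easy.
      field; lra.
Qed.

(* If a sum of powers vanishes on (0, +oo), so does the sum with the
   coefficients weighted by any function of the exponents: powers with
   distinct exponents are linearly independent. *)
Lemma power_sum_free (L : list (R * R)) :
  forall s r : R -> R,
  (forall t, 0 < t -> power_sum s L t = 0) ->
  forall t, 0 < t -> power_sum (fun d => s d * r d) L t = 0.
Proof.
  induction L as [|[c d] L IH]; intros s r H t Ht; [easy|].
  assert (Hd : forall u, 0 < u ->
    power_sum (fun x => s x * x) ((c, d) :: L) u = 0).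
  { intros u Hu.
    pose proof (is_derive_power_sum s ((c, d) :: L) u Hu) as D.
    assert (D0 : is_derive (power_sum s ((c, d) :: L)) u 0).
    { apply (is_derive_ext_loc (fun _ => 0)).
      - exists (mkposreal u Hu); intros y Hy.
        symmetry; apply H.
        unfold ball in Hy; simpl in Hy; unfold AbsRing_ball, abs, minus, plus,
          opp in Hy; simpl in Hy.
        apply Rabs_def2 in Hy; lra.
      - apply is_derive_Reals, derivable_pt_lim_const. }
    apply is_derive_unique in D. apply is_derive_unique in D0.
    rewrite D0 in D.
    replace (power_sum (fun x => s x * x) ((c, d) :: L) u)
      with (power_sum (fun x => s x * x) ((c, d) :: L) u / u * u)
      by (field; lra).
    rewrite <- D; ring. }
  assert (H1 : forall u, 0 < u -> power_sum (fun x => s x * (x - d)) L u = 0).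
  { intros u Hu. specialize (H u Hu); specialize (Hd u Hu).
    rewrite (power_sum_ext _ (fun x => 1 * (s x * x) + (- d) * s x))
      by (intros; ring).
    rewrite power_sum_linear. simpl in H, Hd.
    replace (power_sum s L u) with (- (c * s d * Rpower u d)) by lra.
    replace (power_sum (fun x => s x * x) L u)
      with (- (c * (s d * d) * Rpower u d)) by lra.
    ring. }
  pose proof (IH _ (fun x => (r x - r d) / (x - d)) H1 t Ht) as H2.
  rewrite (power_sum_ext _ (fun x => 1 * (s x * r x) + (- r d) * s x)) in H2.
  - rewrite power_sum_linear in H2. specialize (H t Ht). simpl in H |- *.
    replace (power_sum (fun x => s x * r x) L t)
      with (r d * power_sum s L t) by lra.
    replace (power_sum s L t) with (- (c * s d * Rpower t d)) by lra.
    ring.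
  - intros x. destruct (Req_dec x d) as [->|N]; [|field; lra].
    unfold Rdiv; rewrite !Rminus_diag; ring.
Qed.

Lemma is_frac_deriv_power_sum (gamma : R) (f g : R -> R) :
  is_frac_deriv gamma f g ->
  exists L : list (R * R), forall t, 0 < t ->
    f t = power_sum (fun _ => 1) L t /\
    g t = power_sum (fun d => 1 * (Gamma (d + 1) / Gamma (d - gamma + 1))) L t
          * Rpower t (- gamma).
Proof.
  induction 1 as [d _|a b f1 f2 g1 g2 _ [L HL] _ [M HM]
                 |f1 f2 g1 g2 Ef Eg _ [L HL]].
  - exists ((1, d) :: nil); intros t Ht; simpl; split; [ring|].
    unfold Rminus at 2; rewrite Rpower_plus; ring.
  - exists (map (fun p => (a * fst p, snd p)) L
            ++ map (fun p => (b * fst p, snd p)) M).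
    intros t Ht; destruct (HL t Ht) as [-> ->]; destruct (HM t Ht) as [-> ->].
    rewrite !power_sum_cat, !power_sum_scale; split; ring.
  - exists L; intros t Ht. rewrite <- Ef, <- Eg by easy. now apply HL.
Qed.

Lemma is_frac_deriv_unique (gamma : R) (f g h : R -> R) :
  is_frac_deriv gamma f g -> is_frac_deriv gamma f h ->
  forall t, 0 < t -> g t = h t.
Proof.
  intros Hg Hh.
  assert (Hz : is_frac_deriv gamma (fun t => 1 * f t + (-1) * f t)
                 (fun t => 1 * g t + (-1) * h t))
    by now apply is_frac_deriv_linear.
  destruct (is_frac_deriv_power_sum _ _ _ Hz) as [L HL].
  intros t Ht.
  assert (H0 : forall u, 0 < u -> power_sum (fun _ => 1) L u = 0).
  { intros u Hu. destruct (HL u Hu) as [E _]. lra. }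
  pose proof (power_sum_free L _
    (fun d => Gamma (d + 1) / Gamma (d - gamma + 1)) H0 t Ht) as H1.
  destruct (HL t Ht) as [_ E]. cbv beta in H1. rewrite H1 in E. lra.
Qed.

Lemma frac_deriv_unique (gamma : R) (f g : R -> R) (t : R) :
  is_frac_deriv gamma f g -> 0 < t -> frac_deriv gamma f t = g t.
Proof.
  intros Hg Ht. unfold frac_deriv.
  destruct (epsilon_spec (inhabits 0)
    (fun l => exists h, is_frac_deriv gamma f h /\ h t = l)) as [h [Hh <-]].
  - now exists (g t), g.
  - now apply (is_frac_deriv_unique gamma f).
Qed.

(* Main.v *)
Require Import Defs.
From Stdlib Require Import Reals Lra Lia ZArith.
From Coquelicot Require Import Coquelicot.
Open Scope R_scope.

(** With [q = Gamma (1 - 2 alpha) / Gamma (1 - alpha)] the function is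
    [u x t = P x * t^(-alpha)] for a cubic [P], and the power rule reduces the
    equation to the polynomial identity [P / q = (P ^ 2 / 2)'''].  It holds as
    soon as [q <> 0], that is, as soon as Euler's integral converges to a nonzero
    value on (0, 1); the functional equation reduces the case [alpha > 1/2] to
    the argument [2 - 2 alpha] of that interval. *)

(** Integrals of a nonnegative function grow with the interval, so when bounded they converge to
    their supremum [l]. That [l] bounds them all lets any single interval give a lower estimate of
    the improper integral. *)
Lemma is_RInt_gen_lub (f : R -> R) (M : R) :
  (forall t, 0 < t -> 0 <= f t) ->
  (forall t, 0 < t -> continuous f t) ->
  (forall a b, 0 < a -> a <= b -> RInt f a b <= M) ->
  exists l, is_RInt_gen f (at_right 0) (Rbar_locally p_infty) l /\
            forall a b, 0 < a -> a <= b -> RInt f a b <= l.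
Proof.
  intros Hpos Hcont HM.
  assert (Hex : forall a b, 0 < a -> 0 < b -> ex_RInt f a b).
  { intros a b Ha Hb; apply (@ex_RInt_continuous R_CompleteNormedModule); intros z [Hz _].
    apply Hcont; revert Hz; unfold Rmin; destruct (Rle_dec a b); lra. }
  assert (Hge : forall a b, 0 < a -> a <= b -> 0 <= RInt f a b).
  { intros a b Ha Hb; apply RInt_ge_0; [easy|apply Hex; lra|].
    intros t Ht; apply Hpos; lra. }
  destruct (completeness
    (fun s => exists a b, 0 < a /\ a <= b /\ s = RInt f a b)) as [l [Hub Hlub]].
  - exists M; intros s (a & b & Ha & Hb & ->); now apply HM.
  - exists (RInt f 1 1), 1, 1; repeat split; lra.
  - assert (Hl : forall a b, 0 < a -> a <= b -> RInt f a b <= l).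
    { intros a b Ha Hb; apply Hub; now exists a, b. }
    exists l; split; [|exact Hl].
    intros P [eps HP].
    (* If some [[a0, b0]] comes within [eps] of [l], so does every larger interval; otherwise
       [l - eps] would be a smaller upper bound. *)
    destruct (Classical_Prop.classic
      (exists a b, 0 < a /\ a <= b /\ l - eps < RInt f a b))
      as [(a0 & b0 & Ha0 & Hb0 & Hab)|Hno].
    + apply (Filter_prod _ _ _ (fun a => 0 < a < a0) (fun b => b0 < b)).
      * exists (mkposreal a0 Ha0); intros y Hy Hy0.
        unfold ball in Hy; simpl in Hy.
        unfold AbsRing_ball, abs, minus, plus, opp in Hy; simpl in Hy.
        apply Rabs_def2 in Hy; lra.
      * now exists b0.
      * intros a b Ha Hb; exists (RInt f a b); split.
        { apply (RInt_correct f), Hex; simpl; lra. }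
        apply HP.
        assert (E : RInt f a b = RInt f a a0 + RInt f a0 b0 + RInt f b0 b).
        { rewrite <- (RInt_Chasles f a b0 b), <- (RInt_Chasles f a a0 b0)
            by (apply Hex; lra); reflexivity. }
        pose proof (Hl a b ltac:(lra) ltac:(lra)).
        pose proof (Hge a a0 ltac:(lra) ltac:(lra)).
        pose proof (Hge b0 b ltac:(lra) ltac:(lra)).
        unfold ball; simpl.
        unfold AbsRing_ball, abs, minus, plus, opp; simpl.
        apply Rabs_def1; pose proof (cond_pos eps); lra.
    + exfalso.
      assert (l <= l - eps); [|pose proof (cond_pos eps); lra].
      apply Hlub; intros s (a & b & Ha & Hb & ->).
      apply Rnot_lt_le; intros H; apply Hno; now exists a, b.
Qed.

Lemma Rpower_le_1_plus (t x : R) : 0 < t -> 0 < x <= 1 -> Rpower t x <= 1 + t.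
Proof.
  intros Ht Hx. destruct (Rle_dec t 1) as [H1|H1].
  - apply Rle_trans with (Rpower 1 x); [apply Rle_Rpower_l; lra|].
    unfold Rpower; rewrite ln_1, Rmult_0_r, exp_0; lra.
  - apply Rle_trans with (Rpower t 1); [apply Rle_Rpower; lra|].
    rewrite Rpower_1; lra.
Qed.

Definition Gamma_integrand (x t : R) : R := Rpower t (x - 1) * exp (- t).

Lemma Gamma_integrand_pos (x t : R) : 0 < Gamma_integrand x t.
Proof. apply Rmult_lt_0_compat; apply exp_pos. Qed.

Lemma Gamma_integrand_continuous (x t : R) :
  0 < t -> continuous (Gamma_integrand x) t.
Proof.
  intros Ht; apply (@ex_derive_continuous R_AbsRing R_NormedModule).
  unfold Gamma_integrand, Rpower; auto_derive; lra.
Qed.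

(* The integrand is at most the derivative of [(t^x - 2 - t) e^(-t) / x], the
   difference being [(1 + t - t^x) e^(-t) / x]. *)
Lemma RInt_Gamma_integrand_le (x a b : R) :
  0 < x <= 1 -> 0 < a -> a <= b -> RInt (Gamma_integrand x) a b <= 2 / x.
Proof.
  intros Hx Ha Hab.
  set (K := fun t => (Rpower t x - 2 - t) * exp (- t) / x).
  set (dK := fun t => Gamma_integrand x t
                      + (1 + t - Rpower t x) * exp (- t) / x).
  assert (HK : is_RInt dK a b (K b - K a)).
  { apply (is_RInt_derive K dK); intros t; rewrite Rmin_left by easy;
      intros [Ht _].
    - assert (E : Rpower t x = t * Rpower t (x - 1)).
      (* Relates the power [t^x] in [K] to the power [t^(x-1)] of the integrand, so that [field] can
         compare them. *)
      { rewrite <- (Rpower_1 t) at 2 by lra.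
        rewrite <- Rpower_plus; f_equal; ring. }
      unfold K, dK, Gamma_integrand.
      rewrite E; unfold Rpower in *; auto_derive; [lra|].
      rewrite E; field; lra.
    - apply (@ex_derive_continuous R_AbsRing R_NormedModule).
      unfold dK, Gamma_integrand, Rpower; auto_derive; lra. }
  apply Rle_trans with (RInt dK a b).
  - apply RInt_le; [easy| |now exists (K b - K a)|].
    + apply (@ex_RInt_continuous R_CompleteNormedModule); intros t; rewrite Rmin_left by easy.
      intros [Ht _]; apply Gamma_integrand_continuous; lra.
    + intros t Ht; unfold dK.
      pose proof (Rpower_le_1_plus t x ltac:(lra) Hx).
      assert (0 <= (1 + t - Rpower t x) * exp (- t) / x); [|lra].
      apply Rmult_le_pos; [|left; apply Rinv_0_lt_compat; lra].
      apply Rmult_le_pos; [lra|left; apply exp_pos].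
  (* Here [K b <= 0] because [b^x <= 1 + b], and [- K a <= 2 / x] because
     [2 + a <= 2 (1 + a) <= 2 e^a]. *)
  - rewrite (is_RInt_unique _ _ _ _ HK); unfold K, Rdiv.
    rewrite <- Rmult_minus_distr_r.
    apply Rmult_le_compat_r; [left; apply Rinv_0_lt_compat; lra|].
    pose proof (Rpower_le_1_plus b x ltac:(lra) Hx).
    assert (0 <= (2 + b - Rpower b x) * exp (- b))
      by (apply Rmult_le_pos; [lra|left; apply exp_pos]).
    assert (0 < Rpower a x * exp (- a))
      by (apply Rmult_lt_0_compat; apply exp_pos).
    assert ((2 + a) * exp (- a) <= 2); [|lra].
    rewrite exp_Ropp; apply (Rmult_le_reg_r (exp a)); [apply exp_pos|].
    pose proof (exp_ineq1_le a); pose proof (exp_pos a).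
    rewrite Rmult_assoc, Rinv_l; lra.
Qed.

(** The bound [2 / x] gives convergence, and the limit is at least the integral over [[1, 2]], which
    is positive. *)
Lemma Gamma_integral_pos (x : R) : 0 < x <= 1 -> 0 < Gamma_integral x.
Proof.
  intros Hx.
  destruct (is_RInt_gen_lub (Gamma_integrand x) (2 / x)) as [l [Hl Hge]].
  - intros t _; left; apply Gamma_integrand_pos.
  - intros t; apply Gamma_integrand_continuous.
  - intros a b; now apply RInt_Gamma_integrand_le.
  - unfold Gamma_integral; fold (Gamma_integrand x).
    rewrite (is_RInt_gen_unique _ _ Hl).
    apply Rlt_le_trans with (RInt (Gamma_integrand x) 1 2);
      [|apply Hge; lra].
    apply RInt_gt_0; [lra|intros; apply Gamma_integrand_pos|].
    intros t Ht; apply Gamma_integrand_continuous; lra.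
Qed.

(** [up (- x)] is the only integer [z] with [- x < z <= 1 - x], and the hypothesis makes [n] such an
    integer. *)
Lemma Gamma_shift_eq (x : R) (n : nat) :
  0 < x + INR n < 1 -> Gamma_shift x = n.
Proof.
  intros H; unfold Gamma_shift.
  rewrite <- (tech_up (- x) (Z.of_nat n)); rewrite <- ?INR_IZR_INZ; try lra.
  apply Nat2Z.id.
Qed.

Lemma rising_factorial_neq_0 (x : R) (n : nat) :
  (forall k, (k < n)%nat -> x + INR k <> 0) -> rising_factorial x n <> 0.
Proof.
  induction n as [|n IH]; intros H; simpl; [lra|].
  apply Rmult_integral_contrapositive_currified.
  - apply IH; intros k Hk; apply H; lia.
  - apply H; lia.
Qed.

(** The numerator is Euler's integral at a point of (0, 1), and each factor [x + k] with [k < n] is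
    at most [x + n - 1 < 0]. *)
Lemma Gamma_neq_0 (x : R) (n : nat) : 0 < x + INR n < 1 -> Gamma x <> 0.
Proof.
  intros H; unfold Gamma; rewrite (Gamma_shift_eq x n H).
  apply Rmult_integral_contrapositive_currified.
  - apply Rgt_not_eq, Gamma_integral_pos; lra.
  - apply Rinv_neq_0_compat, rising_factorial_neq_0.
    intros k Hk.
    apply le_INR in Hk; rewrite S_INR in Hk; lra.
Qed.

(** The successive derivatives of [p^2 / 2] are [p p1] and [p1^2 + p p2]; the third is again a
    cubic, to be matched with a multiple of [P]. *)
Lemma Derive_n_3_half_sq_cubic (a b c d x : R) :
  Derive_n (fun y => (a + b * y + c * y ^ 2 + d * y ^ 3) ^ 2 / 2) 3 x
  = 6 * (a * d + b * c) + 12 * (c ^ 2 + 2 * b * d) * x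
    + 60 * c * d * x ^ 2 + 60 * d ^ 2 * x ^ 3.
Proof.
  set (p := fun y => a + b * y + c * y ^ 2 + d * y ^ 3).
  set (p1 := fun y => b + 2 * c * y + 3 * d * y ^ 2).
  set (p2 := fun y => 2 * c + 6 * d * y).
  change (Derive (Derive (Derive (fun y => p y ^ 2 / 2))) x
    = 6 * (a * d + b * c) + 12 * (c ^ 2 + 2 * b * d) * x
      + 60 * c * d * x ^ 2 + 60 * d ^ 2 * x ^ 3).
  rewrite (Derive_ext _ (fun y => p1 y ^ 2 + p y * p2 y)).
  - apply is_derive_unique; unfold p, p1, p2; auto_derive; [easy|ring].
  - intros y; rewrite (Derive_ext _ (fun z => p z * p1 z)).
    + apply is_derive_unique; unfold p, p1, p2; auto_derive; [easy|ring].
    + intros z; apply is_derive_unique; unfold p, p1; auto_derive; [easy|field].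
Qed.

Theorem mainTheorem2 (alpha : R)
  (Halpha : 0 < alpha < 1 / 2 \/ 1 / 2 < alpha < 1)
  (C0 C1 C2 C3 : R)
  (HC0 : C0 = 400 / 3 * (Gamma (1 - 2 * alpha) / Gamma (1 - alpha)) ^ 2)
  (HC1 : C1 = 20 * (Gamma (1 - 2 * alpha) / Gamma (1 - alpha)))
  (HC2 : C2 = 1)
  (HC3 : C3 = Gamma (1 - alpha) / (60 * Gamma (1 - 2 * alpha)))
  (u : R -> R -> R)
  (Hu : forall x t, 0 < t ->
     u x t = C0 / Rpower t alpha + C1 * (x / Rpower t alpha)
             + C2 * (x ^ 2 / Rpower t alpha) + C3 * (x ^ 3 / Rpower t alpha)) :
  forall x t, 0 < t ->
    frac_deriv alpha (fun s => u x s) t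
    = Derive_n (fun y => (u y t) ^ 2 / 2) 3 x.
Proof.
  intros x t Ht.
  assert (G1 : Gamma (1 - alpha) <> 0)
    by (apply (Gamma_neq_0 _ 0); simpl; lra).
  assert (G2 : Gamma (1 - 2 * alpha) <> 0).
  { destruct Halpha;
      [apply (Gamma_neq_0 _ 0)|apply (Gamma_neq_0 _ 1)]; simpl; lra. }
  set (P := C0 + C1 * x + C2 * x ^ 2 + C3 * x ^ 3).
  assert (HL : is_frac_deriv alpha (fun s => u x s)
    (fun s => P * (Gamma (1 - alpha) / Gamma (1 - 2 * alpha)
                   * Rpower s (- alpha - alpha)))).
  { pose proof (is_frac_deriv_power alpha (- alpha)
      ltac:(unfold power_exponent; lra)) as Hp.
    (* The scalar multiple by [P] is the linear combination with coefficients [P] and [0] of the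
       same power with itself. *)
    apply (is_frac_deriv_ext _ _ _ _ _) with
      (3 := is_frac_deriv_linear alpha P 0 _ _ _ _ Hp Hp).
    - intros s Hs; rewrite Hu, Rpower_Ropp by easy; unfold P, Rdiv; ring.
    - intros s _.
      replace (- alpha - alpha + 1) with (1 - 2 * alpha) by ring.
      replace (- alpha + 1) with (1 - alpha) by ring; ring. }
  rewrite (frac_deriv_unique _ _ _ _ HL Ht).
  set (T := Rpower t (- alpha)).
  rewrite (Derive_n_ext _ (fun y => (C0 * T + C1 * T * y + C2 * T * y ^ 2
                                     + C3 * T * y ^ 3) ^ 2 / 2)).
  2: { intros y; rewrite Hu by easy; unfold T; rewrite Rpower_Ropp; f_equal;
       unfold Rdiv; ring. }
  rewrite Derive_n_3_half_sq_cubic.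
  (* The third subtraction is the exponent [- alpha - alpha]: both sides now carry the factor [T^2],
     which leaves the identity between cubics in [x]. *)
  unfold Rminus at 3; rewrite Rpower_plus; fold T.
  unfold P; rewrite HC0, HC1, HC2, HC3; field; now split.
Qed.
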